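(* Let $\beta\in\mathbb C$ with $|\beta|>1$ and let $\mathcal A\subset\mathbb C$ be a finite set with $0\in\mathcal A$. Suppose $(\beta,\mathcal A)$ has the OL Property, witnessed by a bounded set $I\subset\mathbb C$ and $\varepsilon>0$, and suppose $0\in I$. Let $\mathrm{Digit}:(\beta I)^{\varepsilon}\to\mathcal A$ be any function with $B(V,\varepsilon)\subset I+\mathrm{Digit}(V)$ for all $V\in(\beta I)^\varepsilon$, let $\mathrm{Trunc}_{\varepsilon/2}:\mathbb C\to\mathbb C$ be any function with $|X-\mathrm{Trunc}_{\varepsilon/2}(X)|<\varepsilon/2$ for all $X$, and define $\mathrm{Select_M}(U)=\mathrm{Digit}(\mathrm{Trunc}_{\varepsilon/2}(U))$ for $U\in(\beta I)^{\varepsilon/2}$. Then there exists an integer $\delta\ge 1$ such that for all admissible inputs, the on-line multiplication algorithm with delay $\delta$ and selection function $\mathrm{Select_M}$ is well defined (every $W_k$ lies in the domain $(\beta I)^{\varepsilon/2}$ of $\mathrm{Select_M}$) and its output satisfies $\sum_{j=1}^\infty p_j\beta^{-j}=X\cdot Y$.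
   Context: For $x\in\mathbb C$, $\varepsilon>0$, $B(x,\varepsilon)$ is the open ball of center $x$ and radius $\varepsilon$; for $T\subset\mathbb C$, $T^\varepsilon=\bigcup_{x\in T}B(x,\varepsilon)$, $T+a=\{x+a:x\in T\}$, $\beta T=\{\beta x:x\in T\}$. The pair $(\beta,\mathcal A)$ has the OL Property if there exist $\varepsilon>0$ and a bounded set $I\subset\mathbb C$ such that for each $x\in(\beta I)^\varepsilon$ there is $a\in\mathcal A$ with $B(x,\varepsilon)\subset I+a$. On-line multiplication algorithm with delay $\delta\ge1$ and a function $\mathrm{Select_M}$ with values in $\mathcal A$: the inputs are sequences $(x_j)_{j\ge1},(y_j)_{j\ge1}$ in $\mathcal A$ with $x_1=\dots=x_\delta=0$ and $y_1=\dots=y_\delta=0$; put $X=\sum_{j\ge1}x_j\beta^{-j}$, $Y=\sum_{j\ge1}y_j\beta^{-j}$, $X_k=\sum_{j=1}^k x_j\beta^{-j}$, $Y_k=\sum_{j=1}^k y_j\beta^{-j}$. Set $W_0=X_0=Y_0=p_0=0$ and for $k\ge1$: $W_k=\beta(W_{k-1}-p_{k-1})+(x_kY_{k-1}+y_kX_k)$ and $p_k=\mathrm{Select_M}(W_k)\in\mathcal A$. The output is the sequence $(p_k)_{k\ge1}$. *)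

(* Defs.v *)
From Stdlib Require Import Reals Ensembles Finite_sets.
From Coquelicot Require Import Coquelicot.

Open Scope R_scope.

(* Balls are Euclidean: Coquelicot's own [ball] on C is the product (square)
   ball, hence the explicit modulus. *)
Definition Cball (x : C) (eps : R) : Ensemble C :=
  fun z => Cmod (z - x)%C < eps.

Definition thicken (T : Ensemble C) (eps : R) : Ensemble C :=
  fun z => exists x, T x /\ Cball x eps z.

Definition translate (T : Ensemble C) (a : C) : Ensemble C :=
  fun z => exists x, T x /\ z = (x + a)%C.

Definition dilate (beta : C) (T : Ensemble C) : Ensemble C :=
  fun z => exists x, T x /\ z = (beta * x)%C.

Definition Cbounded (T : Ensemble C) : Prop :=
  exists M : R, forall z, T z -> Cmod z <= M.

Definition OL_witness (beta : C) (A : Ensemble C) (I : Ensemble C) (eps : R)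
  : Prop :=
  0 < eps /\ Cbounded I /\
  forall x, thicken (dilate beta I) eps x ->
    exists a, A a /\ Included C (Cball x eps) (translate I a).

(* Digit sequences are indexed from 1: the value at index 0 of a
   [nat -> C] representing one is never used. *)

Definition digit_term (beta : C) (x : nat -> C) (j : nat) : C :=
  (x j / beta ^ j)%C.

(* The empty sum for k = 0. *)
Definition prefix_value (beta : C) (x : nat -> C) (k : nat) : C :=
  sum_n_m (digit_term beta x) 1 k.

Definition has_value (beta : C) (x : nat -> C) (X : C) : Prop :=
  is_series (K := C_AbsRing) (V := C_NormedModule)
    (fun n => digit_term beta x (S n)) X.

Definition admissible (A : Ensemble C) (delta : nat) (x : nat -> C) : Prop :=
  (forall j, (1 <= j)%nat -> A (x j)) /\
  (forall j, (1 <= j <= delta)%nat -> x j = 0%C).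

(* The pair (W_k, p_k).  The delay enters only through [admissible]. *)
Fixpoint mult_run (beta : C) (select : C -> C) (x y : nat -> C) (k : nat)
  : C * C :=
  match k with
  | O => (RtoC 0, RtoC 0)
  | S n =>
      let '(W, p) := mult_run beta select x y n in
      let W' := (beta * (W - p)
                 + (x (S n) * prefix_value beta y n
                    + y (S n) * prefix_value beta x (S n)))%C in
      (W', select W')
  end.

Definition mult_W (beta : C) (select : C -> C) (x y : nat -> C) (k : nat) : C :=
  fst (mult_run beta select x y k).

Definition mult_p (beta : C) (select : C -> C) (x y : nat -> C) (k : nat) : C :=
  snd (mult_run beta select x y k).

(* Partial functions on C are represented by total ones about which nothing is
   assumed outside the domain: [digit] is meant on (beta I)^eps, hence the
   selection function on (beta I)^(eps/2). *)
Definition is_digit_function (beta : C) (A : Ensemble C) (I : Ensemble C)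
    (eps : R) (digit : C -> C) : Prop :=
  forall V, thicken (dilate beta I) eps V ->
    A (digit V) /\ Included C (Cball V eps) (translate I (digit V)).

Definition is_truncation (eta : R) (trunc : C -> C) : Prop :=
  forall X, Cmod (X - trunc X)%C < eta.

Definition select_M (digit trunc : C -> C) (U : C) : C := digit (trunc U).

(* Main.v *)
(** Writing [W k], [p k] for the state of the run, the choice of [digit] gives
    [W k - p k] in [I], so [W (k+1)] lies within
    [|x_(k+1) Y_k + y_(k+1) X_(k+1)|] of [beta I].  The prefix values are
    geometric tails starting after index [delta], hence this error is
    [O(|beta|^(-delta))], which is below [eps / 2] for [delta] large.  The output
    is correct since
    [sum_(j <= k) p_j beta^(-j) = X_k Y_k - (W k - p k) beta^(-k)]
    with [W k - p k] in the bounded set [I]. *)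

Require Import Defs.
From Stdlib Require Import Reals Ensembles Finite_sets Lra Lia.
From Coquelicot Require Import Coquelicot.
Open Scope R_scope.

(** * Bounds on digits, powers and prefix values *)

Lemma Finite_Cbounded (A : Ensemble C) (hA : Finite_sets.Finite C A) :
  exists D : R, 0 <= D /\ forall z, A z -> Cmod z <= D.
Proof.
induction hA as [|A hA [D [D0 HD]] a ha].
- exists 0; split; [lra | intros z []].
- exists (Rmax D (Cmod a)); split.
  + eapply Rle_trans; [exact D0 | apply Rmax_l].
  + intros z [z' Hz | z' Hz].
    * eapply Rle_trans; [now apply HD | apply Rmax_l].
    * destruct Hz; apply Rmax_r.
Qed.

Lemma Cmod_gt_1_neq_0 (beta : C) : 1 < Cmod beta -> beta <> 0%C.
Proof. intros H ->; rewrite Cmod_0 in H; lra. Qed.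

Lemma pow_inv_small (b c : R) :
  1 < b -> 0 < c -> exists n, (1 <= n)%nat /\ (/ b) ^ n < c.
Proof.
intros Hb Hc.
destruct (pow_lt_1_zero (/ b)) with (y := c) as [N HN]; trivial.
- rewrite Rabs_pos_eq.
  + rewrite <- Rinv_1; apply Rinv_lt_contravar; lra.
  + left; apply Rinv_0_lt_compat; lra.
(* Taking [S N] rather than [N] ensures that the exponent, later used as the delay, is at least
   1. *)
- exists (S N); split; [lia|].
  eapply Rle_lt_trans; [apply Rle_abs | apply HN; lia].
Qed.

Lemma prefix_value_0 (beta : C) (x : nat -> C) : prefix_value beta x 0 = 0%C.
Proof. unfold prefix_value; rewrite sum_n_m_zero; [reflexivity | lia]. Qed.

Lemma prefix_value_S (beta : C) (x : nat -> C) (k : nat) :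
  prefix_value beta x (S k) =
  (prefix_value beta x k + x (S k) / beta ^ S k)%C.
Proof. unfold prefix_value; rewrite sum_n_Sm; [reflexivity | lia]. Qed.

Lemma Cmod_div_pow (beta z : C) (k : nat) :
  1 < Cmod beta -> Cmod (z / beta ^ k)%C = Cmod z * (/ Cmod beta) ^ k.
Proof.
intros Hb.
rewrite Cmod_div by (apply Cpow_nz, Cmod_gt_1_neq_0, Hb).
rewrite Cmod_pow, pow_inv; reflexivity.
Qed.

(** With the first [delta] digits zero, the prefix is dominated by the tail of [D * b^(-j)] over
    [j > delta], which sums to [D * b^(-delta) / (b - 1)]. *)
Lemma prefix_value_bound (beta : C) (A : Ensemble C) (D : R) (delta : nat)
  (x : nat -> C) :
  1 < Cmod beta -> 0 <= D -> (forall z, A z -> Cmod z <= D) ->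
  admissible A delta x ->
  forall k, Cmod (prefix_value beta x k) * (Cmod beta - 1)
            <= D * (/ Cmod beta) ^ delta.
Proof.
intros Hb D0 HD [HA Hx] k.
set (b := Cmod beta) in *.
assert (Hi : 0 < / b) by (apply Rinv_0_lt_compat; lra).
assert (Hz : forall j, (j <= delta)%nat -> prefix_value beta x j = 0%C).
{ induction j as [|j IH]; intros Hj; [apply prefix_value_0|].
  rewrite prefix_value_S, IH, Hx by lia; unfold Cdiv; ring. }
assert (Hd : 0 <= D * (/ b) ^ delta)
  by (apply Rmult_le_pos; [lra | apply pow_le; lra]).
(* The bound is strengthened for induction: the second summand is [b - 1] times the geometric tail
   still to come. A new digit adds at most [D * q * (b - 1)] to the first summand, while the second
   drops from [D * b * q] to [D * q]. *)
assert (Hm : forall m, Cmod (prefix_value beta x (delta + m)) * (b - 1)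
             + D * (/ b) ^ (delta + m) <= D * (/ b) ^ delta).
{ induction m as [|m IH].
  - rewrite Nat.add_0_r, Hz, Cmod_0 by lia; lra.
  - rewrite Nat.add_succ_r, prefix_value_S.
    assert (H := Cmod_triangle (prefix_value beta x (delta + m))
                   (x (S (delta + m)) / beta ^ S (delta + m))).
    rewrite Cmod_div_pow in H by exact Hb; fold b in H.
    assert (H1 : Cmod (x (S (delta + m))) <= D) by (apply HD, HA; lia).
    set (q := (/ b) ^ S (delta + m)) in *.
    assert (Hq : 0 <= q) by (apply pow_le; lra).
    assert (Hq' : (/ b) ^ (delta + m) = b * q)
      by (unfold q; simpl; field; lra).
    rewrite Hq' in IH.
    assert (H2 := Rmult_le_compat_r q _ _ Hq H1).
    nra. }
destruct (Nat.le_gt_cases k delta) as [Hk | Hk].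
- rewrite Hz, Cmod_0 by exact Hk; lra.
- specialize (Hm (k - delta)%nat).
  replace (delta + (k - delta))%nat with k in Hm by lia.
  assert (0 <= D * (/ b) ^ k)
    by (apply Rmult_le_pos; [lra | apply pow_le; lra]).
  lra.
Qed.

(** * The recursion and its invariant *)

Lemma mult_W_S (beta : C) (select : C -> C) (x y : nat -> C) (k : nat) :
  mult_W beta select x y (S k) =
  (beta * (mult_W beta select x y k - mult_p beta select x y k)
   + (x (S k) * prefix_value beta y k
      + y (S k) * prefix_value beta x (S k)))%C.
Proof.
unfold mult_W, mult_p; simpl.
destruct (mult_run beta select x y k); reflexivity.
Qed.

Lemma mult_p_S (beta : C) (select : C -> C) (x y : nat -> C) (k : nat) :
  mult_p beta select x y (S k) = select (mult_W beta select x y (S k)).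
Proof.
unfold mult_W, mult_p; simpl.
destruct (mult_run beta select x y k); reflexivity.
Qed.

(** Divided by [beta^(k+1)], the input term of the recursion is exactly the increment
    [X_(k+1) Y_(k+1) - X_k Y_k], so the identity follows by telescoping. *)
Lemma mult_prefix_identity (beta : C) (select : C -> C) (x y : nat -> C)
  (k : nat) :
  beta <> 0%C ->
  prefix_value beta (mult_p beta select x y) k =
  (prefix_value beta x k * prefix_value beta y k
   - (mult_W beta select x y k - mult_p beta select x y k) / beta ^ k)%C.
Proof.
intros Hb; induction k as [|k IH].
- rewrite !prefix_value_0; unfold mult_W, mult_p; simpl.
  unfold Cdiv; ring.
- assert (Hk := Cpow_nz beta k Hb).
  rewrite (prefix_value_S beta (mult_p _ _ _ _)), IH, mult_W_S.
  rewrite !prefix_value_S, Cpow_S.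
  field; now split.
Qed.

(** The two halves of [eps] add up: [U] is [eps / 2]-close to [beta I] and [trunc U] is
    [eps / 2]-close to [U], so [trunc U] is in the domain of [digit], and the ball of radius [eps]
    around it contains [U]. *)
Lemma select_M_residue (beta : C) (A I : Ensemble C) (eps : R)
  (digit trunc : C -> C) (U : C) :
  is_digit_function beta A I eps digit -> is_truncation (eps / 2) trunc ->
  thicken (dilate beta I) (eps / 2) U ->
  I (U - select_M digit trunc U)%C.
Proof.
intros Hd Ht [v [Hv HU]].
unfold Cball in HU.
specialize (Ht U).
assert (Hsym : Cmod (trunc U - U) = Cmod (U - trunc U)).
{ rewrite <- Cmod_opp; f_equal; ring. }
destruct (Hd (trunc U)) as [_ HI].
{ exists v; split; [exact Hv|]; unfold Cball.
  replace (trunc U - v)%C with ((trunc U - U) + (U - v))%C by ring.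
  eapply Rle_lt_trans; [apply Cmod_triangle | lra]. }
destruct (HI U) as [w [Hw HUw]].
{ unfold Ensembles.In, Cball; pose proof (Cmod_ge_0 (U - trunc U)); lra. }
unfold select_M.
replace (U - digit (trunc U))%C with w; [exact Hw|].
rewrite HUw at 1; ring.
Qed.

(** The second conjunct carries the induction: a residue in [I] at step [k] places the next [W] near
    [beta I], which in turn gives a residue in [I]. *)
Lemma mult_W_step (beta : C) (A I : Ensemble C) (eps : R)
  (digit trunc : C -> C) (x y : nat -> C) :
  is_digit_function beta A I eps digit -> is_truncation (eps / 2) trunc ->
  0 < eps -> I 0%C ->
  (forall k, Cmod (x (S k) * prefix_value beta y k
                   + y (S k) * prefix_value beta x (S k))%C < eps / 2) ->
  forall k,
    thicken (dilate beta I) (eps / 2)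
      (mult_W beta (select_M digit trunc) x y k) /\
    I (mult_W beta (select_M digit trunc) x y k
       - mult_p beta (select_M digit trunc) x y k)%C.
Proof.
intros Hd Ht He HI Hs; induction k as [|k [_ IH]].
(* The initial [p] is 0 by definition, not a selected digit, so both claims rest on [0] being in
   [I]. *)
- unfold mult_W, mult_p; simpl; split.
  + exists 0%C; split.
    * exists 0%C; split; [exact HI | ring].
    * unfold Cball; replace (0 - 0)%C with (RtoC 0) by ring.
      rewrite Cmod_0; lra.
  + replace (0 - 0)%C with (RtoC 0) by ring; exact HI.
- assert (HW : thicken (dilate beta I) (eps / 2)
                 (mult_W beta (select_M digit trunc) x y (S k))).
  { rewrite mult_W_S; eexists; split; [eexists; split; [exact IH | reflexivity]|].
    unfold Cball.
    match goal with |- Cmod ?z < _ =>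
      replace z with (x (S k) * prefix_value beta y k
                      + y (S k) * prefix_value beta x (S k))%C by ring end.
    apply Hs. }
  split; [exact HW|].
  rewrite mult_p_S.
  exact (select_M_residue beta A I eps digit trunc _ Hd Ht HW).
Qed.

(** * Passage to the limit *)

Lemma has_value_prefix (beta : C) (x : nat -> C) (X : C) :
  has_value beta x X <->
  filterlim (fun n => prefix_value beta x (S n)) eventually
    (@locally C_UniformSpace X).
Proof.
unfold has_value, is_series, prefix_value.
split; apply filterlim_ext; intros n; unfold sum_n;
  rewrite sum_n_m_S; reflexivity.
Qed.

(* Coquelicot's [filterlim_mult] is about the ball topology of the modulus,
   while series in [C] converge in the product topology. *)
Lemma filterlim_Cmult (u v : nat -> C) (X Y : C) :
  filterlim u eventually (@locally C_UniformSpace X) ->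
  filterlim v eventually (@locally C_UniformSpace Y) ->
  filterlim (fun n => (u n * v n)%C) eventually
    (@locally C_UniformSpace (X * Y)%C).
Proof.
assert (Hto : forall (w : nat -> C) (l : C),
  filterlim w eventually (@locally C_UniformSpace l) ->
  filterlim w eventually (@locally (AbsRing_UniformSpace C_AbsRing) l))
  by (intros w l H P HP; apply H, locally_C, HP).
intros Hu%Hto Hv%Hto P HP%locally_C.
exact (filterlim_comp_2 _ _ _ Hu Hv (filterlim_mult (K := C_AbsRing) X Y) P HP).
Qed.

Lemma bounded_div_pow_lim (beta : C) (M : R) (e : nat -> C) :
  1 < Cmod beta -> (forall k, Cmod (e k) <= M) ->
  filterlim (fun n => (e (S n) / beta ^ S n)%C) eventually
    (@locally C_UniformSpace (RtoC 0)).
Proof.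
intros Hb HM.
assert (Hi : 0 < / Cmod beta) by (apply Rinv_0_lt_compat; lra).
apply (filterlim_norm_zero (V := C_NormedModule)).
apply (is_lim_seq_le_le (fun _ => 0) _ (fun n => M * (/ Cmod beta) ^ S n) 0).
- intros n; split; [apply norm_ge_0|].
  change (Cmod (e (S n) / beta ^ S n) <= M * (/ Cmod beta) ^ S n).
  rewrite Cmod_div_pow by exact Hb.
  apply Rmult_le_compat_r; [apply pow_le; lra | apply HM].
- apply is_lim_seq_const.
- replace 0 with (M * 0) by ring.
  apply (is_lim_seq_scal_l _ M 0).
  apply (is_lim_seq_incr_1 (fun n => (/ Cmod beta) ^ n)), is_lim_seq_geom.
  rewrite Rabs_pos_eq by lra.
  rewrite <- Rinv_1; apply Rinv_lt_contravar; lra.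
Qed.

Lemma mult_has_value (beta : C) (select : C -> C) (x y : nat -> C) (M : R)
  (X Y : C) :
  1 < Cmod beta ->
  (forall k, Cmod (mult_W beta select x y k - mult_p beta select x y k) <= M) ->
  has_value beta x X -> has_value beta y Y ->
  has_value beta (mult_p beta select x y) (X * Y)%C.
Proof.
intros Hb HM HX%has_value_prefix HY%has_value_prefix; apply has_value_prefix.
(* The sign is absorbed into [e], so that the prefix identity becomes a sum of two convergent
   sequences. *)
set (e := fun k => (- (mult_W beta select x y k - mult_p beta select x y k))%C).
assert (He : forall k, Cmod (e k) <= M)
  by (intros k; unfold e; rewrite Cmod_opp; apply HM).
assert (Hlim := filterlim_comp_2 _ _ _ (filterlim_Cmult _ _ _ _ HX HY)
  (bounded_div_pow_lim beta M e Hb He)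
  (filterlim_plus (V := C_NormedModule) (X * Y)%C (RtoC 0))).
match type of Hlim with context [@locally _ ?l] =>
  change l with (X * Y + 0)%C in Hlim end.
rewrite Cplus_0_r in Hlim.
revert Hlim; apply filterlim_ext; intros n.
rewrite mult_prefix_identity by (apply Cmod_gt_1_neq_0, Hb).
unfold e, plus; simpl; unfold Cdiv; ring.
Qed.

Theorem theorem11 (beta : C) (A : Ensemble C) (I : Ensemble C) (eps : R)
  (digit trunc : C -> C)
  (hbeta : 1 < Cmod beta)
  (hAfin : Finite_sets.Finite C A)
  (hA0 : A 0%C)
  (hOL : OL_witness beta A I eps)
  (hI0 : I 0%C)
  (hdigit : is_digit_function beta A I eps digit)
  (htrunc : is_truncation (eps / 2) trunc) :
  exists delta : nat, (1 <= delta)%nat /\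
    forall x y : nat -> C, admissible A delta x -> admissible A delta y ->
      (forall k : nat,
         thicken (dilate beta I) (eps / 2)
           (mult_W beta (select_M digit trunc) x y k)) /\
      (forall X Y : C, has_value beta x X -> has_value beta y Y ->
         has_value beta (mult_p beta (select_M digit trunc) x y) (X * Y)%C).
Proof.
destruct hOL as [He [[M HM] _]].
destruct (Finite_Cbounded A hAfin) as [D [D0 HD]].
(* Each of the two products in the input term is at most [D * D * q / (Cmod beta - 1)] with
   [q = (/ Cmod beta) ^ delta]. The [+ 1] keeps the denominator positive when [D = 0]. *)
set (c := eps / 2 * (Cmod beta - 1) / (2 * D * D + 1)).
assert (HDD : 0 < 2 * D * D + 1) by nra.
assert (Hc : 0 < c) by (apply Rdiv_lt_0_compat; [apply Rmult_lt_0_compat|]; lra).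
destruct (pow_inv_small (Cmod beta) c hbeta Hc) as [delta [Hdelta Hq]].
exists delta; split; [exact Hdelta|].
intros x y Hx Hy.
set (q := (/ Cmod beta) ^ delta) in *.
assert (Hq0 : 0 <= q) by (apply pow_le; left; apply Rinv_0_lt_compat; lra).
assert (Hq' : q * (2 * D * D + 1) < eps / 2 * (Cmod beta - 1)).
{ replace (eps / 2 * (Cmod beta - 1)) with (c * (2 * D * D + 1))
    by (unfold c; field; lra).
  now apply Rmult_lt_compat_r. }
assert (Hs : forall k, Cmod (x (S k) * prefix_value beta y k
               + y (S k) * prefix_value beta x (S k))%C < eps / 2).
{ intros k.
  assert (HX := prefix_value_bound beta A D delta x hbeta D0 HD Hx (S k)).
  assert (HY := prefix_value_bound beta A D delta y hbeta D0 HD Hy k).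
  fold q in HX, HY.
  assert (hx : Cmod (x (S k)) <= D) by (apply HD, Hx; lia).
  assert (hy : Cmod (y (S k)) <= D) by (apply HD, Hy; lia).
  eapply Rle_lt_trans; [apply Cmod_triangle|]; rewrite !Cmod_mult.
  assert (HX0 := Cmod_ge_0 (prefix_value beta x (S k))).
  assert (HY0 := Cmod_ge_0 (prefix_value beta y k)).
  assert (h1 := Rmult_le_compat_r _ _ _ HY0 hx).
  assert (h2 := Rmult_le_compat_r _ _ _ HX0 hy).
  assert (h3 := Rmult_le_compat_l _ _ _ D0 HX).
  assert (h4 := Rmult_le_compat_l _ _ _ D0 HY).
  (* Scaling by [Cmod beta - 1] matches the form of the prefix bounds; [h1] to [h4] then give
     [2 * D * D * q] as an upper bound. *)
  apply (Rmult_lt_reg_r (Cmod beta - 1)); [lra|].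
  nra. }
assert (Hrun := mult_W_step beta A I eps digit trunc x y
                  hdigit htrunc He hI0 Hs).
split; [intros k; apply Hrun|].
intros X Y; apply (mult_has_value _ _ _ _ M); [exact hbeta|].
intros k; apply HM, Hrun.
Qed.
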